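(* Let $G_1$ be an $r_1$-regular graph on $n_1$ vertices and $m_1$ edges, and $G_2$ be an arbitrary graph on $n_2$ vertices. Let $\lambda_1(A_\alpha(G_1))\ge\cdots\ge\lambda_{n_1}(A_\alpha(G_1))$ be the eigenvalues of $A_\alpha(G_1)$. Then for each $\alpha\in[0,1]$, \begin{multline*} \psi_{A_{\alpha}(G_1 \langle \mathrm{v} \rangle G_2)}(x) =\big(x-2\alpha \big)^{m_1 -n_1} \cdot \psi_{A_{\alpha}(G_2)}(x- \alpha n_1)\\ \cdot \prod_{i=2}^{n_1}\Big(x^2 -\big(2\alpha +\alpha r_1+\alpha n_2 + \lambda_i\big(A_{\alpha}(G_1)\big)\big)x + 2{\alpha}^2n_2 +3\alpha r_1 -r_1 + (3\alpha-1)\lambda_i\big(A_{\alpha}(G_1)\big)\Big)\\ \cdot \Big( x^2 -(2\alpha +\alpha r_1 +\alpha n_2 +r_1)x + 2{\alpha}^2n_2 +6\alpha r_1 -2r_1 -n_1(1-\alpha)^2(x-2\alpha) \Gamma_{A_{\alpha}(G_2)}(x-\alpha n_1) \Big). \end{multline*}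
   Context: All graphs are simple, undirected, finite and connected. For a graph $G$ with adjacency matrix $A(G)$ and diagonal degree matrix $D(G)$, and $\alpha\in[0,1]$, $A_{\alpha}(G)=\alpha D(G)+(1-\alpha)A(G)$. For a square matrix $M$ of order $n$, $\psi_M(x)=\det(xI_n-M)$, and $\Gamma_M(x)=\mathbf{1}_n^T(xI_n-M)^{-1}\mathbf{1}_n$, where $\mathbf{1}_n$ is the all-ones column vector. The $R$-graph $\mathcal{R}(G)$ of $G$ is obtained from $G$ by adding, for each edge $e$ of $G$, a new vertex $u_e$ adjacent to both end vertices of $e$ (the edges of $G$ are kept). The $R$-vertex join $G_1 \langle \mathrm{v} \rangle G_2$ is the graph obtained from $\mathcal{R}(G_1)$ and $G_2$ by joining every vertex of $V(G_1)$ with every vertex of $G_2$. The identity is an identity of rational functions in $x$. *)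

(* Defs.v *)
(* Plain MathComp; [complex] is used only to prove [symmetric_spectrum]. *)
From HB Require Import structures.
From mathcomp Require Import all_boot all_order all_algebra.
From mathcomp Require Import complex.

Set Implicit Arguments.
Unset Strict Implicit.
Unset Printing Implicit Defensive.

Import Order.TTheory GRing.Theory Num.Theory.
Local Open Scope ring_scope.

(** ** Graphs *)

Record sgraph := SGraph {
  vertex :> finType;
  adj : rel vertex;
  adj_sym : symmetric adj;
  adj_irr : irreflexive adj }.

(* Connected graphs have at least one vertex. *)
Definition connected_graph (G : sgraph) : Prop :=
  (0 < #|G|)%N /\ forall x y : G, connect (@adj G) x y.

Definition degree (G : sgraph) (x : G) : nat := #|[set y : G | adj x y]|.

Definition regular (r : nat) (G : sgraph) : Prop :=
  forall x : G, degree x = r.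

Definition edges (G : sgraph) : {set {set G}} :=
  [set [set p.1; p.2] | p : G * G & adj p.1 p.2].

Definition edge (G : sgraph) : finType := {e : {set G} | e \in edges G}.

(** [inl x] is an original vertex [x], [inr e] is the added vertex $u_e$. *)
Definition Rgraph_adj (G : sgraph) : rel (G + edge G)%type :=
  fun u v => match u, v with
  | inl x, inl y => adj x y
  | inl x, inr e => x \in val e
  | inr e, inl x => x \in val e
  | inr _, inr _ => false
  end.

Lemma Rgraph_sym G : symmetric (@Rgraph_adj G).
Proof. by case=> [x|e] [y|f] //=; apply: adj_sym. Qed.

Lemma Rgraph_irr G : irreflexive (@Rgraph_adj G).
Proof. by case=> [x|e] //=; apply: adj_irr. Qed.

Definition Rgraph (G : sgraph) : sgraph :=
  SGraph (@Rgraph_sym G) (@Rgraph_irr G).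

Definition Rvjoin_adj (G1 G2 : sgraph) : rel (Rgraph G1 + G2)%type :=
  fun u v => match u, v with
  | inl a, inl b => adj a b
  | inr y, inr z => adj y z
  | inl (inl _), inr _ => true
  | inr _, inl (inl _) => true
  | inl (inr _), inr _ => false
  | inr _, inl (inr _) => false
  end.

Lemma Rvjoin_sym G1 G2 : symmetric (@Rvjoin_adj G1 G2).
Proof. by case=> [[x|e]|y] [[x'|e']|y'] //=; apply: adj_sym. Qed.

Lemma Rvjoin_irr G1 G2 : irreflexive (@Rvjoin_adj G1 G2).
Proof. by case=> [a|y] //=; [case: a => //= x|]; apply: adj_irr. Qed.

Definition Rvjoin (G1 G2 : sgraph) : sgraph :=
  SGraph (@Rvjoin_sym G1 G2) (@Rvjoin_irr G1 G2).

(** ** Matrices of a graph, with the vertices listed as in [enum G] *)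

Definition adjmx (R : rcfType) (G : sgraph) : 'M[R]_#|G| :=
  \matrix_(i, j) (adj (enum_val i) (enum_val j))%:R.

Definition degmx (R : rcfType) (G : sgraph) : 'M[R]_#|G| :=
  diag_mx (\row_i (degree (enum_val i))%:R).

Definition alphamx (R : rcfType) (alpha : R) (G : sgraph) : 'M[R]_#|G| :=
  alpha *: degmx R G + (1 - alpha) *: adjmx R G.

(** [s] lists the eigenvalues of [M] with algebraic multiplicities, in
    nonincreasing order. *)
Definition spectrum (R : rcfType) n (M : 'M[R]_n) (s : n.-tuple R) : Prop :=
  sorted >=%R s /\ char_poly M = \prod_(a <- s) ('X - a%:P).

(** Symmetric matrices, in particular all [alphamx alpha G], have a spectrum. *)
Lemma symmetric_spectrum (R : rcfType) n (M : 'M[R]_n) :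
  M^T = M -> exists s : n.-tuple R, spectrum M s.
Proof.
move=> symM; pose c := real_complex R; pose A : 'M[R[i]]_n := map_mx c M.
have hA : A \is hermsymmx.
  apply/is_hermitianmxP; rewrite expr0 scale1r; apply/matrixP=> i j.
  by rewrite !mxE -[M in LHS]symM mxE /=; apply/eqP; rewrite eq_complex /= oppr0 !eqxx.
pose d := spectral_diag A.
have dr i : d 0 i = c (complex.Re (d 0 i)).
  have /mxOverP/(_ 0 i) := hermitian_spectral_diag_real hA.
  by rewrite -/d; case: (d 0 i) => a b; rewrite complex_real /= => /eqP ->.
pose t := [tuple complex.Re (d 0 i) | i < n].
have cpM : char_poly M = \prod_(a <- t) ('X - a%:P).
  apply: (map_poly_inj c); rewrite map_char_poly -/A.
  rewrite rmorph_prod /= big_map big_enum /=.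
  have /orthomx_spectralP eA := hermitian_normalmx hA.
  have -> : char_poly A = char_poly (diag_mx d).
    have uP := spectral_unit A; rewrite {1}eA /char_poly.
    set P := spectralmx A in uP *; pose Q := map_mx polyC P.
    have uQ : Q \in unitmx by rewrite map_unitmx.
    have -> : char_poly_mx (invmx P *m diag_mx d *m P)
            = invmx Q *m char_poly_mx (diag_mx d) *m Q.
      rewrite /char_poly_mx mulmxBr mulmxBl !map_mxM map_invmx -/Q.
      by congr (_ - _); rewrite scalar_mxC mulmxKV.
    by rewrite !det_mulmx mulrAC -det_mulmx mulVmx // det1 mul1r.
  rewrite char_poly_trig ?diag_mx_is_trig //.
  apply: eq_bigr => i _; rewrite mxE eqxx mulr1n dr.
  by rewrite rmorphB /= map_polyX map_polyC.
exists (sort_tuple >=%R t); split.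
  by apply: sort_sorted => x y; apply: le_total.
by rewrite cpM; apply: perm_big; rewrite perm_sym perm_sort.
Qed.

(** ** Rational functions in one variable over [R] *)

Notation ratfun R := {fraction {poly R}}.

Definition ratC (R : rcfType) (c : R) : ratfun R := tofrac c%:P.

Definition ratX (R : rcfType) : ratfun R := tofrac 'X.

Arguments ratX {R}.

(** $\psi_M(t) = \det(tI_n - M)$. *)
Definition psi (R : rcfType) n (M : 'M[R]_n) (t : ratfun R) : ratfun R :=
  \det (t%:M - map_mx (@ratC R) M).

(** $\Gamma_M(t) = \mathbf{1}_n^T (tI_n - M)^{-1} \mathbf{1}_n$.  The inverse is
    taken over the field of rational functions; the matrix is invertible
    whenever [t] is not a constant. *)
Definition Gamma (R : rcfType) n (M : 'M[R]_n) (t : ratfun R) : ratfun R :=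
  let one_n : 'cV[ratfun R]_n := const_mx 1 in
  (one_n^T *m invmx (t%:M - map_mx (@ratC R) M) *m one_n) 0 0.

(* Main.v *)
(* Write the matrix of the join in blocks, with the vertices ordered as V(G1),
   E(G1), V(G2).  The last two blocks form a block-diagonal matrix, so a Schur
   complement reduces the determinant to order n1.  For an incidence matrix B of
   G1 one has B B^T = D + A, hence after scaling by y = x - 2 alpha the complement
   is a I - b A_alpha(G1) - c J with scalars a, b, c.  The all-ones vector is an
   eigenvector of A_alpha(G1) for r1, so J only changes the factor belonging to
   r1, which is the largest eigenvalue because the entries are nonnegative with
   row sums r1. *)
Require Import Defs.
From HB Require Import structures.
From mathcomp Require Import all_boot all_order all_fingroup all_algebra ring.
Set Implicit Arguments.
Unset Strict Implicit.
Unset Printing Implicit Defensive.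
Import Order.TTheory GRing.Theory Num.Theory.
Local Open Scope ring_scope.

(** * Determinant identities *)

(** Passing from [g] to [f] applies one permutation to both rows and columns, so its sign occurs
    twice and cancels. This lets the vertices of the join be listed in block order. *)
Lemma det_bij_reindex (R : comNzRingType) (T : finType) (h : T -> T -> R)
    m n (f : 'I_m -> T) (g : 'I_n -> T) : bijective f -> bijective g ->
  \det (\matrix_(i, j) h (f i) (f j)) = \det (\matrix_(i, j) h (g i) (g j)).
Proof.
move=> bij_f bij_g; have [g' gK g'K] := bij_g.
have emn : m = n.
  by have := bij_eq_card bij_f; rewrite -(bij_eq_card bij_g) !card_ord.
case: n / emn g bij_g g' gK g'K => g bij_g g' gK g'K.
pose s := perm (bij_inj (bij_comp (Bijective g'K gK) bij_f)).
have -> : \matrix_(i, j) h (f i) (f j)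
        = row_perm s (col_perm s (\matrix_(i, j) h (g i) (g j))).
  by apply/matrixP => i j; rewrite !mxE !permE /= !g'K.
rewrite row_permE col_permE !det_mulmx !det_perm odd_permV mulrCA.
by rewrite -signr_addb addbb mulr1.
Qed.

(** Right multiplication by a unipotent block matrix containing [Y] clears the lower left block; [Y]
    stands for $-D^{-1}C$. *)
Lemma det_block_schur (R : comNzRingType) m n (A : 'M[R]_m) (B : 'M_(m, n))
    (C : 'M_(n, m)) (D : 'M_n) (Y : 'M_(n, m)) : D *m Y = - C ->
  \det (block_mx A B C D) = \det (A + B *m Y) * \det D.
Proof.
move=> DY; have := det_mulmx (block_mx A B C D) (block_mx 1%:M 0 Y 1%:M).
rewrite det_lblock !det1 !mulr1 mulmx_block DY !mulmx1 !mulmx0 !add0r subrr.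
by rewrite det_ublock.
Qed.

(** Sylvester's identity: both sides equal the determinant of the block matrix with identity
    diagonal blocks and [B], [C] off the diagonal, reduced from the right and from the left. *)
Lemma det_1subCM (R : comNzRingType) m n (B : 'M[R]_(m, n)) (C : 'M_(n, m)) :
  \det (1%:M - B *m C) = \det (1%:M - C *m B).
Proof.
have := @det_block_schur R m n 1%:M B C 1%:M (- C).
rewrite mul1mx mulmxN det1 mulr1 => <- //.
have := det_mulmx (block_mx 1%:M 0 (- C) 1%:M) (block_mx 1%:M B C 1%:M).
rewrite det_lblock !det1 !mul1r mulmx_block !mul1mx !mul0mx !addr0 mulmx1.
by rewrite addNr mulNmx [- _ + _]addrC det_ublock det1 mul1r => <-.
Qed.

Lemma horner_char_poly (R : comNzRingType) n (N : 'M[R]_n) t :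
  (char_poly N).[t] = \det (t%:M - N).
Proof.
rewrite -horner_evalE -det_map_mx; congr (\det _); apply/matrixP => i j.
by rewrite !mxE /= /horner_eval hornerD hornerN hornerC hornerMn hornerX.
Qed.

Lemma det_scalar_subZ (F : fieldType) n (N : 'M[F]_n) (s : seq F) a b :
  b != 0 -> char_poly N = \prod_(u <- s) ('X - u%:P) ->
  \det (a%:M - b *: N) = \prod_(u <- s) (a - b * u).
Proof.
move=> b0 cN.
have size_s : size s = n.
  by have := size_char_poly N; rewrite cN size_prod_XsubC => -[].
have -> : a%:M - b *: N = b *: ((a / b)%:M - N).
  by rewrite scalerBr scale_scalar_mx mulrCA divff // mulr1.
(* Since [s] has [n] entries, $b^n$ is a product of [b] over [s] and merges with the product factor
   by factor. *)
rewrite detZ -horner_char_poly cN horner_prod -size_s -iter_mulr_1 -(count_predT s) -big_const_seq.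
by rewrite -big_split /=; apply: eq_bigr => u _ /=; rewrite !hornerE; field.
Qed.

(** As [T] maps the all-ones vector to [t] times itself, $T - cJ = T(I -
    (c/t)\mathbf{1}\mathbf{1}^T)$; Sylvester's identity makes the last determinant one of order
    1. *)
Lemma det_sub_const (F : fieldType) n (T : 'M[F]_n) (t c : F) : t != 0 ->
  T *m const_mx 1 = t *: (const_mx 1 : 'cV_n) ->
  t * \det (T - const_mx c) = \det T * (t - n%:R * c).
Proof.
move=> t0 T1.
have -> : T - const_mx c
    = T *m (1%:M - (c / t) *: const_mx 1 *m (const_mx 1 : 'rV_n)).
  rewrite mulmxBr mulmx1 mulmxA -scalemxAr T1 scalerA divfK //.
  congr (_ - _); apply/matrixP => i j.
  by rewrite !mxE big_ord1 !mxE !mulr1.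
rewrite det_mulmx det_1subCM det_mx11 !mxE.
under eq_bigr do rewrite !mxE mul1r mulr1.
rewrite sumr_const card_ord -[_ / _ *+ _]mulr_natl eqxx.
by rewrite [LHS]mulrCA /=; congr (_ * _); field.
Qed.

(** * Counting incidences between vertices and edges *)

Lemma adj_neq (G : sgraph) (x y : G) : adj x y -> x != y.
Proof. by apply: contraTneq => ->; rewrite adj_irr. Qed.

Lemma edgesP (G : sgraph) (e : {set G}) :
  reflect (exists x y, adj x y /\ e = [set x; y]) (e \in edges G).
Proof.
apply: (iffP imsetP) => [[[x y]]|[x [y [xy ->]]]]; last by exists (x, y); rewrite ?inE.
by rewrite inE => xy ->; exists x, y.
Qed.

Lemma mem_edgesP (G : sgraph) (e : {set G}) x :
  reflect (exists2 y, adj x y & e = [set x; y]) ((e \in edges G) && (x \in e)).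
Proof.
apply: (iffP andP) => [[/edgesP[a [b [ab ->]]]]|[y xy ->]]; last first.
  by rewrite set21; split=> //; apply/edgesP; exists x, y.
rewrite !inE => /orP[]/eqP->; first by exists b.
by exists a; rewrite 1?adj_sym // setUC.
Qed.

Lemma set2_injr (T : finType) (x : T) : injective (fun y => [set x; y]).
Proof.
move=> y z /setP eyz; have := eyz y; have := eyz z.
rewrite !inE !eqxx !orbT; case: (eqVneq y x) => [->|_ _ /esym/eqP //].
by rewrite orbb => /eqP.
Qed.

Lemma card_edge (G : sgraph) : #|edge G| = #|edges G|.
Proof. by rewrite card_sig; apply: eq_card. Qed.

(** The map $y \mapsto \{x, y\}$ is a bijection from the neighbours of [x] to the edges at [x]. *)
Lemma card_edges_at (G : sgraph) (x : G) :
  (\sum_(e : edge G) (x \in val e) = degree x)%N.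
Proof.
rewrite -(big_sub _ (fun e : {set G} => (x \in e) : nat)) /=.
rewrite -big_mkcondr sum1_card /degree -(card_imset _ (@set2_injr _ x)).
apply: eq_card => e; rewrite [LHS]inE; apply/mem_edgesP/imsetP => -[y].
  by move=> xy ->; exists y; rewrite ?inE.
by rewrite inE => xy ->; exists y.
Qed.

Lemma card_edges_at2 (G : sgraph) (x y : G) : x != y ->
  (\sum_(e : edge G) (x \in val e) * (y \in val e) = adj x y)%N.
Proof.
move=> xy; rewrite -(big_sub _ (fun e : {set G} => (x \in e) * (y \in e))%N) /=.
under eq_bigr do rewrite mulnb; rewrite -big_mkcondr sum1_card.
(* The only edge that can contain both vertices is $\{x, y\}$, so the truth value becomes the size
   of a set with at most one element. *)
have -> : (adj x y : nat) = #|[set e | (e == [set x; y]) && adj x y]|.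
  case: (adj x y); last by apply/esym/eq_card0 => e; rewrite inE andbF.
  by rewrite -[LHS](cards1 [set x; y]); apply: eq_card => e; rewrite !inE andbT.
apply: eq_card => e; rewrite [LHS]inE [RHS]inE andbA.
apply/andP/andP => [[/mem_edgesP[z xz ->]]|[/eqP-> axy]]; last first.
  by rewrite set22; split=> //; apply/mem_edgesP; exists y.
by rewrite !inE eq_sym (negPf xy) => /eqP->.
Qed.

Lemma card_edge_verts (G : sgraph) (e : edge G) : (\sum_x (x \in val e) = 2)%N.
Proof.
rewrite -big_mkcond sum1_card; case: e => e /= /edgesP[x [y [/adj_neq xy ->]]].
by rewrite cards2 xy.
Qed.

Lemma degreeE (G : sgraph) (x : G) : degree x = (\sum_y adj x y)%N.
Proof. by rewrite /degree -sum1dep_card -big_mkcond. Qed.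

(** * Vertex degrees in the join *)

(** Each edge of [G1] at [x] gives two neighbours, its other end and its added vertex. *)
Lemma degree_Rvjoin_vertex (G1 G2 : sgraph) (x : G1) :
  @degree (Rvjoin G1 G2) (inl (inl x)) = (degree x + degree x + #|G2|)%N.
Proof.
by rewrite degreeE !big_sumType /= -degreeE card_edges_at sum1_card.
Qed.

Lemma degree_Rvjoin_edge (G1 G2 : sgraph) (e : edge G1) :
  @degree (Rvjoin G1 G2) (inl (inr e)) = 2.
Proof.
by rewrite degreeE !big_sumType /= card_edge_verts !big1_eq.
Qed.

Lemma degree_Rvjoin_join (G1 G2 : sgraph) (y : G2) :
  @degree (Rvjoin G1 G2) (inr y) = (#|G1| + degree y)%N.
Proof.
by rewrite degreeE !big_sumType /= -degreeE big1_eq sum1_card addn0.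
Qed.

(** * Entries and row sums of [alphamx]; the incidence matrix *)

Lemma alphamxE (R : rcfType) (alpha : R) (G : sgraph) i j :
  alphamx alpha G i j =
    alpha * (degree (enum_val i))%:R *+ (enum_val i == enum_val j)
    + (1 - alpha) * (adj (enum_val i) (enum_val j))%:R.
Proof. by rewrite !mxE (inj_eq enum_val_inj) [X in X + _ = _]mulrnAr. Qed.

Lemma alphamx_tr (R : rcfType) (alpha : R) (G : sgraph) :
  (alphamx alpha G)^T = alphamx alpha G.
Proof.
apply/matrixP => i j; rewrite !mxE adj_sym eq_sym.
by case: eqVneq => [->|].
Qed.

Lemma alphamx_regular (R : rcfType) (alpha : R) (G : sgraph) r : regular r G ->
  alphamx alpha G = (alpha * r%:R)%:M + (1 - alpha) *: adjmx R G.
Proof.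
move=> regG; apply/matrixP => i j.
by rewrite !mxE regG [X in X + _ = _]mulrnAr.
Qed.

Lemma alphamx_regular_ones (R : rcfType) (alpha : R) (G : sgraph) r :
  regular r G -> alphamx alpha G *m const_mx 1 = r%:R *: (const_mx 1 : 'cV_#|G|).
Proof.
move=> regG; rewrite (alphamx_regular _ regG) mulmxDl mul_scalar_mx -scalemxAl.
have -> : adjmx R G *m const_mx 1 = r%:R *: (const_mx 1 : 'cV_#|G|).
  apply/matrixP => i j; rewrite !mxE mulr1 -(regG (enum_val i)) degreeE natr_sum.
  rewrite [RHS](big_enum_val (fun y : G => (adj (enum_val i) y)%:R)).
  by apply: eq_bigr => k _; rewrite !mxE mulr1.
by rewrite scalerA -scalerDl; congr (_ *: _); ring.
Qed.

Definition incmx (R : pzRingType) (G : sgraph) : 'M[R]_(#|G|, #|edge G|) :=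
  \matrix_(i, j) (enum_val i \in val (enum_val j : edge G))%:R.

(** Each entry counts the edges containing two given vertices: the degree on the diagonal, the
    adjacency off it. *)
Lemma incmx_mul_tr (R : rcfType) (G : sgraph) :
  incmx R G *m (incmx R G)^T = degmx R G + adjmx R G.
Proof.
apply/matrixP => i j; rewrite !mxE.
under eq_bigr do rewrite !mxE -natrM.
rewrite -(big_enum_val
  (fun e : edge G => ((enum_val i \in val e) * (enum_val j \in val e))%:R : R)).
rewrite -natr_sum; case: eqVneq => [<-|neq_ij].
  rewrite adj_irr addr0 mulr1n; congr (_%:R); rewrite -card_edges_at.
  by apply: eq_bigr => e _; rewrite mulnb andbb.
by rewrite add0r card_edges_at2 // (inj_eq enum_val_inj).
Qed.

(** * Block form of the matrix of the join *)

Definition Rvjoin_val (G1 G2 : sgraph)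
    (i : 'I_(#|G1| + (#|edge G1| + #|G2|))) : Rvjoin G1 G2 :=
  match split i with
  | inl a => inl (inl (enum_val a))
  | inr b => match split b with
             | inl e => inl (inr (enum_val e))
             | inr c => inr (enum_val c)
             end
  end.

Lemma Rvjoin_val_bij (G1 G2 : sgraph) : bijective (@Rvjoin_val G1 G2).
Proof.
pose g (u : Rvjoin G1 G2) : 'I_(#|G1| + (#|edge G1| + #|G2|)) := match u with
  | inl (inl v) => unsplit (inl (enum_rank v))
  | inl (inr e) => unsplit (inr (unsplit (inl (enum_rank e))))
  | inr w => unsplit (inr (unsplit (inr (enum_rank w))))
  end.
exists g => [i|[[v|e]|w]]; rewrite /g /Rvjoin_val ?unsplitK ?enum_rankK //.
rewrite -[RHS]splitK; case: (split i) => [a|b]; first by rewrite enum_valK.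
by rewrite -[b in RHS]splitK; case: (split b) => [e|c]; rewrite enum_valK.
Qed.

(** The morphism [phi] will be [ratC]; keeping it abstract leaves computations in an arbitrary
    field. *)
Lemma det_Rvjoin (R : rcfType) (F : fieldType) (phi : {rmorphism R -> F})
    (G1 G2 : sgraph) (r1 : nat) (alpha : R) (x : F) :
  regular r1 G1 ->
  let n1 := #|G1| in
  let s := phi (1 - alpha) in
  \det (x%:M - map_mx phi (alphamx alpha (Rvjoin G1 G2))) =
  \det (block_mx
    ((x - phi (alpha * (r1 + r1 + #|G2|)%:R))%:M - s *: map_mx phi (adjmx R G1))
    (row_mx (- s *: map_mx phi (incmx R G1)) (const_mx (- s)))
    (col_mx (- s *: (map_mx phi (incmx R G1))^T) (const_mx (- s)))
    (block_mx (x - phi (2 * alpha))%:M 0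
      0 ((x - phi (alpha * n1%:R))%:M - map_mx phi (alphamx alpha G2)))).
Proof.
move=> regG n1 s.
(* The entry as a function of two vertices, independent of how they are listed; its values on the
   nine pairs of vertex classes give the blocks. *)
pose h (u v : Rvjoin G1 G2) := x *+ (u == v)
  - phi (alpha * (degree u)%:R *+ (u == v) + (1 - alpha) * (adj u v)%:R).
have -> : x%:M - map_mx phi (alphamx alpha (Rvjoin G1 G2))
        = \matrix_(i, j) h (enum_val i) (enum_val j).
  apply/matrixP => i j; rewrite [RHS]mxE /h (inj_eq enum_val_inj).
  by rewrite [LHS]mxE [_%:M _ _]mxE [in LHS]mxE [map_mx _ _ _ _]mxE alphamxE
     (inj_eq enum_val_inj).
rewrite (det_bij_reindex h (@enum_val_bij _) (@Rvjoin_val_bij G1 G2)).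
have hVV v w : h (inl (inl v)) (inl (inl w))
    = (x - phi (alpha * (r1 + r1 + #|G2|)%:R)) *+ (v == w) - s * phi (adj v w)%:R.
  rewrite /h degree_Rvjoin_vertex regG rmorphD rmorphMn [phi ((1 - _) * _)]rmorphM /=.
  by rewrite opprD addrA -mulrnBl.
have hVE v e : h (inl (inl v)) (inl (inr e)) = - s * phi (v \in val e)%:R.
  by rewrite /h !mulr0n !add0r rmorphM mulNr.
have hEV v e : h (inl (inr e)) (inl (inl v)) = - s * phi (v \in val e)%:R.
  by rewrite /h !mulr0n !add0r rmorphM mulNr.
have hEE e e' : h (inl (inr e)) (inl (inr e')) = (x - phi (2 * alpha)) *+ (e == e').
  rewrite /h degree_Rvjoin_edge mulr0 addr0 rmorphMn /= [alpha * _]mulrC.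
  by rewrite -mulrnBl.
have hVJ v w : h (inl (inl v)) (inr w) = - s.
  by rewrite /h !mulr0n !add0r mulr1.
have hJV v w : h (inr w) (inl (inl v)) = - s.
  by rewrite /h !mulr0n !add0r mulr1.
have hEJ e w : h (inl (inr e)) (inr w) = 0.
  by rewrite /h !mulr0n !add0r mulr0 rmorph0 oppr0.
have hJE e w : h (inr w) (inl (inr e)) = 0.
  by rewrite /h !mulr0n !add0r mulr0 rmorph0 oppr0.
have hJJ v w : h (inr v) (inr w) = (x - phi (alpha * n1%:R)) *+ (v == w)
    - phi (alpha * (degree v)%:R *+ (v == w) + (1 - alpha) * (adj v w)%:R).
  rewrite /h degree_Rvjoin_join natrD mulrDr mulrnDl -addrA [phi (_ + (_ + _))]rmorphD /=.
  by rewrite opprD addrA rmorphMn /= -mulrnBl.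
have ev (T : finType) (k l : 'I_#|T|) : (enum_val k == enum_val l) = (k == l).
  exact: (inj_eq enum_val_inj).
congr (\det _); apply/matrixP => i j; rewrite [LHS]mxE /Rvjoin_val !mxE.
case: (split i) => a; rewrite !mxE; case: (split j) => b; rewrite !mxE.
- by rewrite hVV ev.
- by case: (split b) => c; rewrite !mxE ?hVE ?hVJ.
- by case: (split a) => c; rewrite !mxE ?hEV ?hJV.
case: (split a) => c; rewrite !mxE; case: (split b) => d; rewrite !mxE.
- by rewrite hEE ev.
- by rewrite hEJ.
- by rewrite hJE.
by rewrite hJJ -!ev [alpha * (_ *+ (_ == _))]mulrnAr.
Qed.

(** * The Schur complement and its determinant *)

(** With [X] the inverse of [S], this is where $\Gamma$ arises, as the coefficient of an all-ones
    matrix. *)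
Lemma mul_const_mx (R : pzRingType) m n (u v : R) (X : 'M[R]_n) :
  const_mx u *m X *m const_mx v
    = const_mx (u * ((const_mx 1 : 'cV_n)^T *m X *m const_mx 1 : 'M_1) 0 0 * v)
  :> 'M_m.
Proof.
apply/matrixP => i j; rewrite !mxE mulr_sumr mulr_suml.
apply: eq_bigr => k _; rewrite !mxE mulr1; congr (_ * _).
by rewrite mulr_sumr; apply: eq_bigr => l _; rewrite !mxE mul1r.
Qed.

(** Here [t] is the eigenvalue of $aI - bA_\alpha(G_1)$ at the all-ones vector. The factors
    $y^{n_1}$ and [t] on the left replace divisions. *)
Lemma det_Rvjoin_spectrum (R : rcfType) (F : fieldType)
    (phi : {rmorphism R -> F}) (G1 G2 : sgraph) (r1 : nat) (alpha : R)
    (lambda : seq R) (x : F) :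
  regular r1 G1 ->
  char_poly (alphamx alpha G1) = \prod_(l <- lambda) ('X - l%:P) ->
  let n1 := #|G1| in
  let y := x - phi (2 * alpha) in
  let S := (x - phi (alpha * n1%:R))%:M - map_mx phi (alphamx alpha G2) in
  let a := y * (x - phi (alpha * (r1 + #|G2|)%:R))
           - phi ((1 - alpha) * (1 - 2 * alpha) * r1%:R) in
  let b := y + phi (1 - alpha) in
  let c := y * phi (1 - alpha) ^+ 2
           * ((const_mx 1 : 'cV_#|G2|)^T *m invmx S *m const_mx 1 : 'M_1) 0 0 in
  let t := a - b * phi r1%:R in
  y != 0 -> b != 0 -> t != 0 -> S \in unitmx ->
  y ^+ n1 * (t * \det (x%:M - map_mx phi (alphamx alpha (Rvjoin G1 G2)))) =
  y ^+ #|edges G1| * \det S * \prod_(l <- lambda) (a - b * phi l)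
    * (t - phi n1%:R * c).
Proof.
move=> regG cpG n1 y S a b c t y0 b0 t0 uS.
rewrite (@det_Rvjoin _ _ phi _ G2 _ alpha x regG) -/n1 -/y -/S.
set s := phi (1 - alpha); set P := _ - _ *: _; set B := map_mx phi (incmx R G1).
(* The lower right block is the block sum of $yI$ and [S]; inverting each part against $-sB^T$ and
   $-sJ$ gives the two components of this witness. *)
rewrite (@det_block_schur _ _ _ _ _ _ _
  (col_mx ((s / y) *: B^T) (s *: invmx S *m const_mx 1))); last first.
  rewrite mul_block_col !mul0mx addr0 add0r opp_col_mx mul_scalar_mx scalerA.
  rewrite mulrCA divff // mulr1 scaleNr opprK; congr col_mx.
  rewrite -scalemxAl -scalemxAr mulmxA mulmxV // mul1mx.
  by apply/matrixP => i j; rewrite !mxE mulr1 opprK.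
rewrite det_ublock det_scalar -card_edge mul_row_col.
have BBt : B *m B^T = map_mx phi (degmx R G1 + adjmx R G1).
  by rewrite -incmx_mul_tr map_mxM map_trmx.
rewrite -!scalemxAl -!scalemxAr mulmxA mul_const_mx BBt.
have -> : degmx R G1 = r1%:R%:M.
  by apply/matrixP => i j; rewrite !mxE regG.
set K := P + _.
suff yK : y *: K = (a%:M - b *: map_mx phi (alphamx alpha G1)) - const_mx c.
  transitivity (y ^+ #|edge G1| * \det S * (t * \det (y *: K))).
    by rewrite detZ [LHS]mulrCA [RHS]mulrC -!mulrA.
  rewrite yK -[RHS]mulrA rmorph_nat; congr (_ * _); rewrite (det_sub_const _ t0); last first.
    have -> : const_mx 1 = map_mx phi (const_mx 1) :> 'cV_n1.
      by rewrite map_const_mx rmorph1.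
    rewrite mulmxBl mul_scalar_mx -scalemxAl -map_mxM.
    by rewrite (alphamx_regular_ones _ regG) map_mxZ scalerA -scalerBl.
  rewrite (det_scalar_subZ (s := [seq phi l | l <- lambda])) ?big_map //.
  rewrite -map_char_poly cpG rmorph_prod /=; apply: eq_bigr => l _.
  by rewrite rmorphB /= map_polyX map_polyC.
rewrite /K /P /a /b /c (alphamx_regular _ regG) /s.
move: (_ 0 0) => g.
(* Eliminating [x] leaves [y] as the only denominator in the entrywise identity. *)
have xE : x = y + 2 * phi alpha by rewrite /y rmorphM rmorph_nat subrK.
apply/matrixP => i j; rewrite !mxE; move: (adj _ _) => e; rewrite xE.
rewrite !natrD !(rmorphB, rmorphD, rmorphM, rmorphMn, rmorph_nat, rmorph1) /=.
move: (phi alpha) y0 => p; clearbody y; clear.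
move: y (r1%:R) (#|G2|%:R) (e%:R) => z r n v z0.
by case: (i == j); rewrite ?mulr1n ?mulr0n; field.
Qed.

(** * The largest eigenvalue of a regular graph *)

(** Compare coordinate [j] of the eigenvector equation, where [v] has maximal absolute value: the
    entries are nonnegative with row sums [r], so $|l v_j| \le r |v_j|$. *)
Lemma alphamx_eigenvalue_le (R : rcfType) (alpha : R) (G : sgraph) r l :
  0 <= alpha <= 1 -> regular r G -> eigenvalue (alphamx alpha G) l -> l <= r%:R.
Proof.
case/andP=> alpha_ge0 alpha_le1 regG /eigenvalueP[v vN /rV0Pn[i0 vi0]].
case: (@arg_maxP _ _ _ i0 xpredT (fun i => `|v 0 i|)) => // j _ vmax.
have vj : 0 < `|v 0 j| by apply: lt_le_trans (vmax i0 _); rewrite ?normr_gt0.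
rewrite -(ler_pM2r vj); apply: (le_trans (ler_norm _)).
rewrite normrM normr_id -normrM.
have -> : l * v 0 j = \sum_i v 0 i * alphamx alpha G i j.
  by have /matrixP/(_ 0 j) := vN; rewrite !mxE.
apply: (le_trans (ler_norm_sum _ _ _)).
have <- : \sum_i alphamx alpha G j i * 1 = r%:R.
  have /matrixP/(_ j 0) := alphamx_regular_ones alpha regG.
  by rewrite !mxE mulr1 => <-; apply: eq_bigr => i _; rewrite [const_mx _ _ _]mxE.
rewrite mulr_suml; apply: ler_sum => i _; rewrite mulr1 normrM mulrC.
have -> : alphamx alpha G i j = alphamx alpha G j i by rewrite -[in LHS](alphamx_tr alpha G) mxE.
have N_ge0 : 0 <= alphamx alpha G j i.
  by rewrite alphamxE addr_ge0 ?mulrn_wge0 ?mulr_ge0 ?subr_ge0 ?ler0n.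
by rewrite ger0_norm // ler_wpM2l //; exact: vmax.
Qed.

(** The degree bounds all eigenvalues and is itself one, so it heads the sorted list. *)
Lemma spectrum_regular_head (R : rcfType) (alpha : R) (G : sgraph) r
    (lambda : #|G|.-tuple R) :
  (0 < #|G|)%N -> 0 <= alpha <= 1 -> regular r G ->
  spectrum (alphamx alpha G) lambda -> lambda`_0 = r%:R.
Proof.
move=> G_gt0 alpha01 regG [sorted_lambda cpN].
have eig l : eigenvalue (alphamx alpha G) l = (l \in lambda).
  by rewrite eigenvalue_root_char cpN root_prod_XsubC.
have size_gt0 : (0 < size lambda)%N by rewrite size_tuple.
apply/le_anti/andP; split.
  by apply: alphamx_eigenvalue_le alpha01 regG _; rewrite eig mem_nth.
have : r%:R \in lambda.
  rewrite -eig; apply/eigenvalueP; exists (const_mx 1).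
    (* [eigenvalue] refers to row vectors; symmetry transfers the column identity. *)
    apply: trmx_inj; rewrite trmx_mul alphamx_tr linearZ /= trmx_const.
    exact: alphamx_regular_ones.
  by apply/rV0Pn; exists (Ordinal G_gt0); rewrite mxE oner_eq0.
case/(nthP 0) => i lt_i <-.
by apply: (sorted_leq_nth ge_trans ge_refl).
Qed.

(** * The factors of the formula as rational functions *)

(** The left side is $a - bl$, the eigenvalue of the scaled complement before the all-ones term is
    subtracted. *)
Lemma Rvjoin_factorE (R : rcfType) (F : fieldType) (phi : {rmorphism R -> F})
    (alpha l : R) (r n : nat) (x : F) :
  (x - phi (2 * alpha)) * (x - phi (alpha * (r + n)%:R))
    - phi ((1 - alpha) * (1 - 2 * alpha) * r%:R)
    - (x - phi (2 * alpha) + phi (1 - alpha)) * phi l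
  = x ^+ 2 - phi (2 * alpha + alpha * r%:R + alpha * n%:R + l) * x
    + phi (2 * alpha ^+ 2 * n%:R + 3 * alpha * r%:R - r%:R + (3 * alpha - 1) * l).
Proof.
rewrite !natrD !(rmorphB, rmorphD, rmorphM, rmorphXn, rmorph_nat, rmorph1) /=.
by ring.
Qed.

(** The exponent is an integer because a tree has $m_1 - n_1 = -1$. *)
Lemma mulf_exprz_cancel (F : fieldType) (y t d P p L : F) (m n : nat) :
  y != 0 -> t != 0 ->
  y ^+ n * (t * d) = y ^+ m * P * (t * p) * L ->
  d = y ^ (m%:Z - n%:Z) * P * p * L.
Proof.
move=> y0 t0 e; apply: (mulfI t0); apply: (mulfI (expf_neq0 n y0)); rewrite e.
rewrite expfzDr // -exprnN -exprnP; have := expf_neq0 n y0.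
by move: (y ^+ m) (y ^+ n) => u v v0; field.
Qed.

HB.instance Definition _ (R : rcfType) :=
  GRing.RMorphism.copy (@ratC R) (@tofrac {poly R} \o polyC).

(** The value is the image of the monic characteristic polynomial of $M + cI$. It makes the matrix
    inverted in $\Gamma$ a unit. *)
Lemma psi_neq0 (R : rcfType) n (M : 'M[R]_n) c : psi M (ratX - ratC c) != 0.
Proof.
have -> : psi M (ratX - ratC c) = tofrac (char_poly (M + c%:M)).
  rewrite /psi /char_poly -det_map_mx; congr (\det _); apply/matrixP => i j.
  rewrite !mxE rmorphB /= rmorphMn polyCD rmorphD opprD.
  by rewrite polyCMn rmorphMn /= mulrnBl -addrA [- _ - _]addrC.
by rewrite tofrac_eq0 monic_neq0 ?char_poly_monic.
Qed.

Lemma ratX_sub_ratC_neq0 (R : rcfType) (c : R) : ratX - ratC c != 0.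
Proof. by rewrite /ratX /ratC -rmorphB tofrac_eq0 polyXsubC_eq0. Qed.

Lemma ratX_quadratic_neq0 (R : rcfType) (u v : R) :
  ratX ^+ 2 - ratC u * ratX + ratC v != 0.
Proof.
rewrite /ratX /ratC -rmorphXn -rmorphM -rmorphB -rmorphD tofrac_eq0.
apply/eqP => /polyP/(_ 2); rewrite !coefE /= mulr0 subr0 addr0.
by apply/eqP/oner_neq0.
Qed.

(* [lambda`_i] is 0-indexed: it is the (i+1)-st largest eigenvalue. *)
Theorem theorem3 (R : rcfType) (G1 G2 : sgraph) (r1 : nat) (alpha : R)
    (lambda : #|G1|.-tuple R) :
  connected_graph G1 -> connected_graph G2 ->
  regular r1 G1 ->
  0 <= alpha <= 1 ->
  spectrum (alphamx alpha G1) lambda ->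
  let n1 := #|G1| in
  let m1 := #|edges G1| in
  let n2 := #|G2| in
  let x : ratfun R := ratX in
  psi (alphamx alpha (Rvjoin G1 G2)) x =
    (x - ratC (2 * alpha)) ^ (m1%:Z - n1%:Z)
    * psi (alphamx alpha G2) (x - ratC (alpha * n1%:R))
    * (\prod_(1 <= i < n1)
         (x ^+ 2
          - ratC (2 * alpha + alpha * r1%:R + alpha * n2%:R + lambda`_i) * x
          + ratC (2 * alpha ^+ 2 * n2%:R + 3 * alpha * r1%:R - r1%:R
                  + (3 * alpha - 1) * lambda`_i)))
    * (x ^+ 2
       - ratC (2 * alpha + alpha * r1%:R + alpha * n2%:R + r1%:R) * x
       + ratC (2 * alpha ^+ 2 * n2%:R + 6 * alpha * r1%:R - 2 * r1%:R)
       - ratC (n1%:R * (1 - alpha) ^+ 2) * (x - ratC (2 * alpha))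
         * Gamma (alphamx alpha G2) (x - ratC (alpha * n1%:R))).
Proof.
move=> [G1_gt0 _] _ regG alpha01 specG n1 m1 n2 x.
have [_ cpG] := specG.
pose y := x - ratC (2 * alpha).
have y0 : y != 0 by apply: ratX_sub_ratC_neq0.
pose q l := x ^+ 2 - ratC (2 * alpha + alpha * r1%:R + alpha * n2%:R + l) * x
  + ratC (2 * alpha ^+ 2 * n2%:R + 3 * alpha * r1%:R - r1%:R + (3 * alpha - 1) * l).
have q0 l : q l != 0 by apply: ratX_quadratic_neq0.
pose a := y * (x - ratC (alpha * (r1 + n2)%:R))
           - ratC ((1 - alpha) * (1 - 2 * alpha) * r1%:R).
pose b := y + ratC (1 - alpha).
have b0 : b != 0.
  have -> : b = x - ratC (2 * alpha - (1 - alpha)).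
    by rewrite rmorphB opprB addrA addrAC.
  exact: ratX_sub_ratC_neq0.
have qE l : a - b * ratC l = q l by apply: (Rvjoin_factorE (@ratC R)).
have uS : (x - ratC (alpha * n1%:R))%:M - map_mx (@ratC R) (alphamx alpha G2)
    \in unitmx by rewrite unitmxE unitfE; apply: psi_neq0.
have t0 : a - b * ratC r1%:R != 0.
  by have e := qE r1%:R; rewrite e; apply: q0.
have := det_Rvjoin_spectrum (phi := @ratC R) (x := x) regG cpG y0 b0 t0 uS.
rewrite -[\det (x%:M - _)]/(psi _ _) -/n1 -/n2 -/m1 -/y -/a -/b.
(* The factor at index 0 belongs to [r1], hence equals the [t] on the left and cancels. *)
rewrite (big_nth 0) size_tuple big_ltn //.
rewrite (spectrum_regular_head _ alpha01 regG specG) //.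
move=> e; apply: (mulf_exprz_cancel y0 t0); apply: (etrans e).
congr (_ * (_ * _) * _).
  by apply: eq_bigr => i _; apply: qE.
(* At $l = r_1$ the constant term $3\alpha r_1 - r_1 + (3\alpha - 1)l$ becomes $6\alpha r_1 -
   2r_1$. *)
have e1 := qE r1%:R; rewrite e1 /q; congr (_ + ratC _ - _); first by ring.
rewrite [in RHS]rmorphM [in RHS]rmorphXn /=.
rewrite -[RHS]mulrA -[RHS]mulrA; congr (_ * _).
by rewrite -[LHS]mulrA [LHS]mulrCA.
Qed.
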